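(* Consider the distributed feedforward linear quadratic problem $$\inf_{G(\lambda)\in S_{\mathcal{A}}^{m\times n}}\ \lim_{M\to\infty}\frac1M\sum_{t=1}^M\mathbf{E}\|z(t)\|^2\quad\text{subject to } x(t+1)=Ax(t)+Bu(t)+w(t),\ z(t)=Cx(t)+Du(t),\ u(t)=-\sum_{s=0}^\infty g(s)w(t-1-s),$$ where $G(\lambda)=\sum_{s\ge0}g(s)\lambda^s$, and the distributed estimation problem $$\inf_{L(\lambda)\in S_{\mathcal{A}^T}^{n\times m}}\ \lim_{M\to\infty}\frac1M\sum_{t=1}^M\sum_{i=1}^N\mathbf{E}\|\bar x_i(t)-\hat x_i(t)\|^2\quad\text{subject to } \bar x(t+1)=A^T\bar x(t)+C^T\bar w(t),\ y(t)=B^T\bar x(t)+D^T\bar w(t),\ \hat x(t)=\sum_{s=0}^\infty l(s)y(t-1-s),$$ where $L(\lambda)=\sum_{s\ge0}l(s)\lambda^s$. Then the solutions of the two problems are related by $$g(s)=l^T(s)\quad\text{for all } s\ge0,$$ that is, $\sum_{s\ge0}g(s)\lambda^s\in S_{\mathcal{A}}^{m\times n}$ is a solution (attains the infimum) of the feedforward problem if and only if $\sum_{s\ge0}l(s)\lambda^s$ with $l(s)=g(s)^T$ lies in $S_{\mathcal{A}^T}^{n\times m}$ and is a solution of the estimation problem.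
   Context: Setting: $N$ interconnected systems, with dimensions $n=\sum_{i=1}^N n_i$ and $m=\sum_{i=1}^N m_i$ (all $n_i,m_i\geq 1$). The matrix $A\in\mathbb{R}^{n\times n}$ has blocks $A_{ij}\in\mathbb{R}^{n_i\times n_j}$; $B=\mathrm{diag}(B_{11},\dots,B_{NN})\in\mathbb{R}^{n\times m}$ is block diagonal with $B_{ii}\in\mathbb{R}^{n_i\times m_i}$ of full column rank; $C\in\mathbb{R}^{q\times n}$ and $D\in\mathbb{R}^{q\times m}$. Here $x(t),\bar x(t),\hat x(t)\in\mathbb{R}^n$ are partitioned into blocks of sizes $n_1,\dots,n_N$ (e.g. $\bar x_i(t)\in\mathbb{R}^{n_i}$), and $u(t),y(t)\in\mathbb{R}^m$ into blocks of sizes $m_1,\dots,m_N$; $z(t)\in\mathbb{R}^q$. The disturbances satisfy $w(t)=0$, $\bar w(t)=0$ for $t<0$, and for $t\ge0$ they are sequences of mutually uncorrelated Gaussian vectors $w(t)\sim\mathcal{N}(0,I_n)$, $\bar w(t)\sim\mathcal{N}(0,I_q)$; $x(t)=\bar x(t)=0$ for all $t\le0$. $\mathcal{A}\in\{0,1\}^{N\times N}$ is the adjacency matrix of the interconnection graph: for $i\ne j$, $\mathcal{A}_{ij}=1$ if $A_{ij}\neq0$ and $\mathcal{A}_{ij}=0$ if $A_{ij}=0$; every node has one loop, so $\mathcal{A}_{ii}=1$ for all $i$. Powers $\mathcal{A}^t$ ($\mathcal{A}^0=I$) are computed over the non-negative integers (not modulo 2). For $\mathcal{E}\in\{\mathcal{A},\mathcal{A}^T\}$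 and $a,b\in\{m,n\}$, with $[M]_{ij}$ denoting the $(i,j)$ block (of size $a_i\times b_j$) of an $a\times b$ matrix $M$, the sparsity structure given by $\mathcal{E}$ is the set of formal power series $$S_{\mathcal{E}}^{a\times b}=\Big\{\sum_{t\ge 0}g(t)\lambda^t \;:\; g(t)\in\mathbb{R}^{a\times b},\ [\mathcal{E}^t]_{ij}=0\Rightarrow [g(t)]_{ij}=0 \text{ for all } t\ge 0 \text{ and all } i,j\Big\}.$$ *)

(* Defs.v *)
From HB Require Import structures.
From mathcomp Require Import all_boot all_order all_algebra.
From mathcomp Require Import all_classical all_reals all_analysis.

Set Implicit Arguments.
Unset Strict Implicit.
Unset Printing Implicit Defensive.

Import Order.TTheory GRing.Theory Num.Theory.
Import numFieldNormedType.Exports.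

Local Open Scope classical_set_scope.
Local Open Scope ring_scope.

(* Euclidean; the library norm on matrices is the max norm. *)
Definition sqnorm (R : realType) (k : nat) (v : 'cV[R]_k) : R :=
  \sum_(i < k) v i 0 ^+ 2.

(* The law of X is N(0, I_k), i.e. the product of k copies of N(0, 1). *)
Definition std_gaussian d (T : measurableType d) (R : realType)
    (P : probability T R) (k : nat) (X : T -> 'cV[R]_k) : Prop :=
  (forall i, measurable_fun [set: T] (fun om => X om i 0)) /\
  (forall V : 'I_k -> set R, (forall i, measurable (V i)) ->
     P [set om | forall i, V i (X om i 0)]
     = (\prod_(i < k) normal_prob 0 1 (V i))%E).

(* Two vectors are uncorrelated when their cross-covariance matrix vanishes. *)
Definition white_noise d (T : measurableType d) (R : realType)
    (P : probability T R) (k : nat) (w : int -> T -> 'cV[R]_k) : Prop :=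
  [/\ forall t : int, t < 0 -> forall om, w t om = 0,
      forall t : int, 0 <= t -> std_gaussian P (w t)
    & forall s t : int, 0 <= s -> 0 <= t -> s != t -> forall i j,
        covariance P (fun om => w s om i 0) (fun om => w t om j 0) = 0%E].

Fixpoint state_nat (R : realType) (k : nat) (A : 'M[R]_k)
    (v : int -> 'cV[R]_k) (t : nat) : 'cV[R]_k :=
  if t is t'.+1 then A *m state_nat A v t' + v t'%:Z else 0.

Definition state (R : realType) (k : nat) (A : 'M[R]_k)
    (v : int -> 'cV[R]_k) (t : int) : 'cV[R]_k :=
  if t is Posz t' then state_nat A v t' else 0.

Lemma state_le0 (R : realType) (k : nat) (A : 'M[R]_k)
    (v : int -> 'cV[R]_k) (t : int) : t <= 0 -> state A v t = 0.
Proof. by case: t => [[|t]|t]. Qed.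

Lemma state_succ (R : realType) (k : nat) (A : 'M[R]_k)
    (v : int -> 'cV[R]_k) (t : int) :
  (forall s : int, s < 0 -> v s = 0) ->
  state A v (t + 1) = A *m state A v t + v t.
Proof.
move=> v0; case: t => [t|t]; first by rewrite -PoszD addn1.
by rewrite v0// state_le0 ?mulmx0 ?addr0// NegzE -addn1 PoszD opprD addrNK oppr_le0.
Qed.

(* Strictly causal filter: v(t) = sum_{s >= 0} g(s) w(t - 1 - s). *)
Definition filter_out (R : realType) (a b : nat) (g : nat -> 'M[R]_(a, b))
    (w : int -> 'cV[R]_b) (t : int) : 'cV[R]_a :=
  limn (fun k : nat => \sum_(0 <= s < k) g s *m w (t - 1 - s%:Z)).

(* The Cesaro limit exists in [0, +oo] in both problems below, where the
   expectation is nondecreasing in t. *)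
Definition average (R : realType) (e : int -> \bar R) : \bar R :=
  limn (fun M : nat => ((M%:R : R)^-1)%:E * \sum_(1 <= t < M.+1) e t%:Z)%E.

(* A power series sum_t g(t) lambda^t is given by its coefficients. *)
Definition sparse (R : realType) (N : nat) (E : 'M[nat]_N)
    (a b : 'I_N -> nat) :
    set (nat -> 'M[R]_(\sum_i a i, \sum_i b i)) :=
  [set g | forall (t : nat) (i j : 'I_N),
     (E ^+ t) i j = 0 -> submxblock (g t) i j = 0].

Arguments sparse R {N} E a b.

Section problems.
Context (R : realType) (N : nat) (n_ m_ : 'I_N -> nat) (q : nat).
Local Notation n := (\sum_i n_ i)%N.
Local Notation m := (\sum_i m_ i)%N.
Context (A : 'M[R]_n) (B : 'M[R]_(n, m)) (C : 'M[R]_(q, n)) (D : 'M[R]_(q, m)).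

(* Entries in nat, so that powers are computed over the non-negative integers. *)
Definition adjacency : 'M[nat]_N :=
  \matrix_(i, j) nat_of_bool ((i == j) || (submxblock A i j != 0)).

Section feedforward.
Context d (T : measurableType d) (P : probability T R).
Context (w : int -> T -> 'cV[R]_n) (g : nat -> 'M[R]_(m, n)).

Definition ff_u (t : int) (om : T) : 'cV[R]_m :=
  - filter_out g (w ^~ om) t.

Definition ff_x (t : int) (om : T) : 'cV[R]_n :=
  state A (fun t' => B *m ff_u t' om + w t' om) t.

Definition ff_z (t : int) (om : T) : 'cV[R]_q :=
  C *m ff_x t om + D *m ff_u t om.

Definition ff_cost : \bar R :=
  average (fun t => 'E_P[fun om => sqnorm (ff_z t om)])%E.

End feedforward.

Section estimation.
Context d (T : measurableType d) (P : probability T R).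
Context (wbar : int -> T -> 'cV[R]_q) (l : nat -> 'M[R]_(n, m)).

Definition est_x (t : int) (om : T) : 'cV[R]_n :=
  state A^T (fun t' => C^T *m wbar t' om) t.

Definition est_y (t : int) (om : T) : 'cV[R]_m :=
  B^T *m est_x t om + D^T *m wbar t om.

Definition est_xhat (t : int) (om : T) : 'cV[R]_n :=
  filter_out l (est_y ^~ om) t.

Definition est_cost : \bar R :=
  average (fun t => \sum_(i < N)
    'E_P[fun om => sqnorm (submxcol (est_x t om) i
                           - submxcol (est_xhat t om) i)])%E.

End estimation.

End problems.

(* g solves the problem inf_{h in S} J(h). *)
Definition is_solution (R : realType) (X : Type) (S : set X) (J : X -> \bar R)
    (g : X) : Prop :=
  S g /\ J g = ereal_inf [set J h | h in S].

(* Main.v *)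
(** With [X 0 = 1] and [X (s+1) = A X s - B g s], both costs at time [t] are
    [c * \sum_(s < t) |C X s - D g s|_F^2], where [c] is the second moment of
    N(0, 1). In the feedforward problem [z t = \sum_(s < t) (C X s - D g s) w (t - 1 - s)],
    while for [l s = (g s)^T] the estimation error at time [t] is
    [\sum_(s < t) (C X s - D g s)^T wbar (t - 1 - s)], and the Frobenius norm is
    invariant under transposition. Transposition also exchanges the two sparsity
    constraints, so the two problems coincide. *)

Require Import Defs.
From HB Require Import structures.
From mathcomp Require Import all_boot all_order all_algebra.
From mathcomp Require Import all_classical all_reals all_analysis.
From mathcomp Require Import measurable_realfun zify ring lra.

Set Implicit Arguments.
Unset Strict Implicit.
Unset Printing Implicit Defensive.

Import Order.TTheory GRing.Theory Num.Theory.
Import numFieldNormedType.Exports.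

Local Open Scope classical_set_scope.
Local Open Scope ring_scope.

(** * Symmetry and moments of the centred normal law *)

Lemma normal_pdf_opp (R : realType) (s x : R) : s != 0 ->
  normal_pdf 0 s (- x) = normal_pdf 0 s x.
Proof.
by move=> s0; rewrite normal_pdfE// /normal_fun !subr0 sqrrN.
Qed.

(** The law is absolutely continuous, and its Radon-Nikodym derivative equals [normal_pdf] almost
    everywhere because both have the same integral over every measurable set. *)
Lemma ge0_integral_normal_prob (R : realType) (m s : R) (f : R -> \bar R) :
  measurable_fun [set: R] f -> (forall x, (0 <= f x)%E) ->
  (\int[normal_prob m s]_x f x =
   \int[lebesgue_measure]_x (f x * (normal_pdf m s x)%:E))%E.
Proof.
move=> mf f0.
have numu : normal_prob m s `<< lebesgue_measure by exact: normal_prob_dominates.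
rewrite -(Radon_Nikodym_SigmaFinite.change_of_variables numu)//.
apply: ae_eq_integral => //=.
- apply: emeasurable_funM => //.
  exact: measurable_int (Radon_Nikodym_SigmaFinite.f_integrable numu).
- apply: emeasurable_funM => //.
  by apply/measurable_EFinP; exact: measurable_normal_pdf.
- apply: ae_eqe_mul2l.
  apply: integral_ae_eq => //=.
  + exact: Radon_Nikodym_SigmaFinite.f_integrable.
  + by apply/measurable_EFinP; exact: measurable_normal_pdf.
  + by move=> E _ mE; rewrite -Radon_Nikodym_SigmaFinite.f_integral.
Qed.

(** The density is even and Lebesgue measure is invariant under reflection. *)
Lemma normal_prob_opp (R : realType) (s : R) (A : set R) : s != 0 ->
  measurable A -> normal_prob 0 s (-%R @^-1` A) = normal_prob 0 s A.
Proof.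
move=> s0 mA; rewrite /normal_prob.
transitivity (\int[lebesgue_measure]_(x in -%R @^-1` A)
   ((fun y => (normal_pdf 0 s y)%:E) \o -%R) x)%E.
  by apply: eq_integral => x _ /=; rewrite normal_pdf_opp.
rewrite -(@ge0_integral_pushforward _ _ (measurableTypeR R) (measurableTypeR R))//=.
- by apply: eq_measure_integral => B mB _; exact: lebesgue_measureN.
- apply/measurable_EFinP; apply: measurable_funTS; exact: measurable_normal_pdf.
- by move=> y _; rewrite lee_fin normal_pdf_ge0.
Qed.

Lemma normal_prob_integrable_sqr (R : realType) :
  (normal_prob (0 : R) 1).-integrable setT (fun x => (x ^+ 2)%:E).
Proof.
have mX2 : measurable_fun [set: R] (fun x : R => (x ^+ 2)%:E).
  by apply/measurable_EFinP; exact: measurable_funX.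
apply/integrableP; split => //.
under eq_integral do rewrite gee0_abs ?lee_fin ?sqr_ge0//.
rewrite ge0_integral_normal_prob//; last by move=> x; rewrite lee_fin sqr_ge0.
(* [u <= expR u] at [u = x ^+ 2 / 4] trades the factor [x ^+ 2] for a larger variance *)
pose c : R := 4 * normal_peak 1 / normal_peak (Num.sqrt 2).
have s2 : Num.sqrt 2 != 0 :> R by rewrite gt_eqF// sqrtr_gt0.
apply: (@le_lt_trans _ _
  (\int[lebesgue_measure]_x (c%:E * (normal_pdf 0 (Num.sqrt 2) x)%:E))%E).
  apply: ge0_le_integral => //=.
  - by move=> x _; rewrite -EFinM lee_fin mulr_ge0 ?sqr_ge0 ?normal_pdf_ge0.
  - apply: emeasurable_funM => //.
    by apply/measurable_EFinP; exact: measurable_normal_pdf.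
  - apply/measurable_EFinP; apply: measurable_funM => //.
    exact: measurable_normal_pdf.
  move=> x _; rewrite -!EFinM lee_fin !normal_pdfE ?oner_eq0//.
  have p2 : normal_peak (Num.sqrt 2) != 0 :> R by rewrite gt_eqF ?normal_peak_gt0.
  have -> y : c * (normal_peak (Num.sqrt 2) * y) = normal_peak 1 * (4 * y).
    by rewrite /c; field.
  rewrite mulrCA ler_wpM2l ?normal_peak_ge0//.
  rewrite /normal_fun !subr0 sqr_sqrtr// expr1n.
  (* The two exponents are [- u - u] and [- u]; cancelling [4] and one factor [expR (- u)] leaves
     [u * expR (- u) <= 1]. *)
  set u : R := x ^+ 2 / 4.
  have -> : - x ^+ 2 / (1 *+ 2) = - u - u by rewrite /u; field.
  have -> : - x ^+ 2 / (2 *+ 2) = - u by rewrite /u; field.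
  have -> : x ^+ 2 = 4 * u by rewrite /u; field.
  rewrite -mulrA ler_wpM2l// expRD mulrA ler_piMl ?expR_ge0//.
  rewrite expRN ler_pdivrMr ?expR_gt0// mul1r.
  by rewrite (le_trans _ (expR_ge1Dx _))// lerDr.
rewrite integralZl//=; last exact: integrable_normal_pdf.
by rewrite integral_normal_pdf mule1 ltry.
Qed.

(** Domination by [X ^+ 2 + Y ^+ 2]. *)
Lemma integrableM_sqr d (T : measurableType d) (R : realType)
    (mu : {measure set T -> \bar R}) (X Y : T -> R) :
  measurable_fun setT X -> measurable_fun setT Y ->
  mu.-integrable setT (EFin \o (fun om => X om ^+ 2)) ->
  mu.-integrable setT (EFin \o (fun om => Y om ^+ 2)) ->
  mu.-integrable setT (EFin \o (fun om => X om * Y om)).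
Proof.
move=> mX mY iX iY; apply: (le_integrable measurableT _ _ (integrableD measurableT iX iY)).
  by apply/measurable_EFinP; exact: measurable_funM.
move=> om _ /=; rewrite lee_fin normrM [leRHS]ger0_norm ?addr_ge0 ?sqr_ge0//.
rewrite -(real_normK (num_real (X om))) -(real_normK (num_real (Y om))).
by have := sqr_ge0 (`|X om| - `|Y om|); have := sqr_ge0 (`|X om| + `|Y om|); nra.
Qed.

Lemma integrable_of_sqr d (T : measurableType d) (R : realType)
    (P : probability T R) (X : T -> R) :
  measurable_fun setT X ->
  P.-integrable setT (EFin \o (fun om => X om ^+ 2)) ->
  P.-integrable setT (EFin \o X).
Proof.
move=> mX iX; have := @integrableM_sqr _ _ _ P X (cst 1) mX.
rewrite /comp/=; under [in X in _ -> _ -> _ -> X]eq_fun do rewrite mulr1.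
apply=> //; rewrite expr1n.
exact: finite_measure_integrable_cst.
Qed.

Lemma normal_prob_integrable (R : realType) :
  (normal_prob (0 : R) 1).-integrable setT EFin.
Proof.
apply: (@integrable_of_sqr _ (measurableTypeR R) R (normal_prob 0 1) id) => //.
exact: normal_prob_integrable_sqr.
Qed.

(** By symmetry of the law the integral equals its own opposite; being finite, it vanishes. *)
Lemma integral_normal_prob_id (R : realType) :
  (\int[normal_prob (0 : R) 1]_x x%:E = 0)%E.
Proof.
have iN := normal_prob_integrable R.
have iNn : (normal_prob (0 : R) 1).-integrable setT
    (EFin \o (-%R : measurableTypeR R -> measurableTypeR R)).
  exact: integrableN iN.
have : (\int[normal_prob (0 : R) 1]_x x%:E =
        - \int[normal_prob (0 : R) 1]_x x%:E)%E.
  rewrite -[RHS]integralN/=; last exact: integrable_add_def.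
  rewrite [RHS](_ : _ = \int[normal_prob (0 : R) 1]_(x in -%R @^-1` setT)
     (EFin \o (-%R : measurableTypeR R -> measurableTypeR R)) x)%E//.
  rewrite -(@integral_pushforward _ _ (measurableTypeR R) (measurableTypeR R))//.
  by apply: eq_measure_integral => A mA _; apply/esym/normal_prob_opp.
have := integrable_fin_num measurableT iN.
case: (\int[_]_x _)%E => // r _ [rN]; congr EFin; lra.
Qed.

(** * Moments of a standard Gaussian vector *)

Section std_gaussian_moments.
Context d (T : measurableType d) (R : realType) (P : probability T R) (k : nat).
Context (X : T -> 'cV[R]_k) (gX : std_gaussian P X).
Local Notation gauss := (normal_prob (0 : R) 1).

Let mX i : measurable_fun setT (fun om => X om i 0 : measurableTypeR R).
Proof. exact: gX.1. Qed.

Let mXR i : measurable_fun setT (fun om => X om i 0).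
Proof. exact: gX.1. Qed.

Lemma std_gaussian_law i (A : set R) : measurable A ->
  P ((fun om => X om i 0) @^-1` A) = gauss A.
Proof.
(* Test sets equal to [setT] off coordinate [i] contribute factors 1, which isolates the
   marginal. *)
move=> mA; have := gX.2 (fun j => if j == i then A else setT).
rewrite (bigD1 i)//= eqxx big1 => [|j /negbTE ->]; last first.
  exact: (@probability_setT _ _ _ gauss).
rewrite mule1 => <-; last by move=> j; case: ifP.
congr (P _); apply/seteqP; split => [om Aom j|om /(_ i)]; last by rewrite eqxx.
by case: eqP => // ->.
Qed.

Lemma std_gaussian_law2 i j (A B : set R) : i != j ->
  measurable A -> measurable B ->
  P ((fun om => (X om i 0, X om j 0)) @^-1` (A `*` B)) = (gauss A * gauss B)%E.
Proof.
move=> ij mA mB.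
have := gX.2 (fun l => if l == i then A else if l == j then B else setT).
have ji : (j == i) = false by rewrite eq_sym (negbTE ij).
rewrite (bigD1 i)//= eqxx (bigD1 j) ?ji//= eqxx.
rewrite big1 => [|l /andP[/negbTE -> /negbTE ->]]; last first.
  exact: (@probability_setT _ _ _ gauss).
rewrite mule1 => <-; last by move=> l; case: ifP => // _; case: ifP.
congr (P _); apply/seteqP; split => [om [Aom Bom] l|om Hom].
  by case: eqP => [->//|_]; case: eqP => [->|].
by split; [have := Hom i|have := Hom j]; rewrite ?ji eqxx.
Qed.

Lemma std_gaussian_sqr i :
  (\int[P]_om (X om i 0 ^+ 2)%R%:E = \int[gauss]_x (x ^+ 2)%R%:E)%E.
Proof.
transitivity (\int[pushforward P
  (fun om => X om i 0%R : measurableTypeR R)]_x (x ^+ 2)%R%:E)%E.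
  rewrite ge0_integral_pushforward//.
  - by apply/measurable_EFinP; exact: measurable_funX.
  - by move=> y _; rewrite lee_fin sqr_ge0.
by apply: eq_measure_integral => A mA _; exact: std_gaussian_law.
Qed.

Lemma std_gaussian_integrable_sqr i :
  P.-integrable setT (EFin \o (fun om => X om i 0 ^+ 2)).
Proof.
apply/integrableP; split.
  by apply/measurable_EFinP; exact: measurable_funX.
under eq_integral do rewrite /= ger0_norm ?sqr_ge0//.
rewrite std_gaussian_sqr.
by have /(integrable_fin_num measurableT)/fin_numPlt/andP[_] := normal_prob_integrable_sqr R.
Qed.

Lemma std_gaussian_integrable i : P.-integrable setT (EFin \o (fun om => X om i 0)).
Proof. exact/integrable_of_sqr/std_gaussian_integrable_sqr. Qed.

Lemma std_gaussian_mean i : (\int[P]_om (X om i 0)%R%:E = 0)%E.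
Proof.
transitivity (\int[pushforward P (fun om => X om i 0%R : measurableTypeR R)]_x x%:E)%E.
  by rewrite integral_pushforward//; exact: std_gaussian_integrable.
rewrite -(integral_normal_prob_id R).
by apply: eq_measure_integral => A mA _; exact: std_gaussian_law.
Qed.

Lemma std_gaussian_integrable_cross i j :
  P.-integrable setT (EFin \o (fun om => X om i 0 * X om j 0)).
Proof. by apply: integrableM_sqr => //; exact: std_gaussian_integrable_sqr. Qed.

(** Distinct coordinates are independent: their joint law is the product measure, and the inner
    integral in Fubini is a multiple of the mean, which is 0. *)
Lemma std_gaussian_cross i j : i != j ->
  (\int[P]_om (X om i 0 * X om j 0)%R%:E = 0)%E.
Proof.
move=> ij; pose Z om : measurableTypeR R * measurableTypeR R := (X om i 0, X om j 0).
have mZ : measurable_fun setT Z by exact: measurable_fun_pair.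
pose ZM := isMeasurableFun.Build _ _ _ _ _ mZ.
pose ZF : {mfun T >-> (measurableTypeR R * measurableTypeR R)%type} := HB.pack Z ZM.
pose f (z : measurableTypeR R * measurableTypeR R) := (z.1 * z.2)%:E.
have mf : measurable_fun setT f by apply/measurable_EFinP; exact: measurable_funM.
have pushE (A : set (measurableTypeR R * measurableTypeR R)) : measurable A ->
    (gauss \x gauss)%E A = distribution P ZF A.
  (* Agreement on rectangles determines the product measure. *)
  by apply: product_measure_unique => B C mB mC; exact: std_gaussian_law2.
have iP : P.-integrable setT (f \o Z) := std_gaussian_integrable_cross i j.
transitivity (\int[pushforward P Z]_z f z)%E.
  by rewrite integral_pushforward.
transitivity (\int[gauss \x gauss]_z f z)%E.
  by apply: eq_measure_integral => A mA _; exact/esym/pushE.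
rewrite -integral12_prod_meas1; last first.
  have /integrableP[_ iZ] := integrable_pushforward mZ mf iP measurableT.
  apply/integrableP; split => //.
  rewrite (@eq_measure_integral _ _ _ _ (pushforward P Z))// => A mA _.
  exact: pushE.
rewrite /fubini_F /f /=; apply: integral0_eq => x _.
under eq_integral do rewrite EFinM.
by rewrite integralZl//; [rewrite integral_normal_prob_id mule0|exact: normal_prob_integrable].
Qed.

End std_gaussian_moments.

(** * Second moments of white noise *)

Section white_noise_moments.
Context d (T : measurableType d) (R : realType) (P : probability T R) (k : nat).
Context (w : int -> T -> 'cV[R]_k) (wP : white_noise P w).

Let gw (s : nat) : std_gaussian P (w s).
Proof. by case: wP => _ + _; exact. Qed.

Lemma white_noise_integrable (s t : nat) i j :
  P.-integrable setT (EFin \o (fun om => w s om i 0 * w t om j 0)).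
Proof.
apply: integrableM_sqr; [exact: (gw s).1|exact: (gw t).1|..];
  exact: std_gaussian_integrable_sqr.
Qed.

Lemma white_noise_cross (s t : nat) i j :
  (\int[P]_om (w s om i 0 * w t om j 0)%R%:E =
   if (s == t) && (i == j) then \int[normal_prob (0 : R) 1]_x (x ^+ 2)%R%:E
   else 0)%E.
Proof.
have [<-{t}/=|st /=] := eqVneq s t.
  have [<-|ij] := eqVneq i j; last exact: std_gaussian_cross.
  by rewrite -(std_gaussian_sqr (gw s) i).
have [_ _ /(_ s t erefl erefl st i j)] := wP.
(* Both means vanish, so the covariance is the integral of the uncentred product. *)
rewrite unlock unlock /= !(std_gaussian_mean (gw _)) => cov0.
rewrite -[RHS]cov0; apply: eq_integral => om _.
by congr (_ * _)%:E; exact/esym/subr0.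
Qed.

End white_noise_moments.

(** * Expected energy of filtered white noise *)

Lemma integral_quadratic_form d (T : measurableType d) (R : realType)
    (P : probability T R) (J : finType) (f : J -> T -> R) (K : J -> J -> R)
    (c : R) :
  (forall a b, P.-integrable setT (EFin \o (fun om => f a om * f b om))) ->
  (forall a b, \int[P]_om (f a om * f b om)%R%:E = if a == b then c%:E else 0)%E ->
  ('E_P[fun om => (\sum_a \sum_b K a b * (f a om * f b om))%R] =
   (c * \sum_a K a a)%R%:E)%E.
Proof.
move=> fi fE; rewrite unlock.
transitivity (\int[P]_om \sum_a \sum_b ((K a b)%:E * (f a om * f b om)%R%:E))%E.
  by apply: eq_integral => om _; rewrite -sumEFin; under eq_bigr do rewrite -sumEFin.
have Ki a b : P.-integrable setT (fun om => (K a b)%:E * (f a om * f b om)%R%:E)%E.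
  exact: integrableZl (fi a b).
(* Orthogonality kills the off-diagonal terms, so only [c] times the trace of [K] survives. *)
have KE a b : (\int[P]_om ((K a b)%:E * (f a om * f b om)%R%:E) =
    if a == b then (c * K a a)%R%:E else 0)%E.
  rewrite integralZl//; last exact: fi.
  rewrite fE; case: eqP => [<-|_]; last by rewrite mule0.
  by rewrite -EFinM mulrC.
rewrite (integral_sum measurableT); last by move=> a; exact: integrable_sum.
rewrite mulr_sumr -sumEFin; apply: eq_bigr => a _.
rewrite (integral_sum measurableT)// (bigD1 a)//= KE eqxx big1 ?adde0// => b ba.
by rewrite KE eq_sym (negbTE ba).
Qed.

Definition frobenius_sq (R : realType) (p k : nat) (M : 'M[R]_(p, k)) : R :=
  \sum_i \sum_j M i j ^+ 2.

Lemma frobenius_sq_tr (R : realType) (p k : nat) (M : 'M[R]_(p, k)) :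
  frobenius_sq M^T = frobenius_sq M.
Proof.
rewrite /frobenius_sq exchange_big.
by apply: eq_bigr => i _; apply: eq_bigr => j _; rewrite mxE.
Qed.

(** Reassembles the estimation cost, which is summed over subsystems: pairs of a block and a row
    inside it enumerate the rows of [M]. *)
Lemma sum_frobenius_sq_submxcol (R : realType) (N : nat) (n_ : 'I_N -> nat)
    (k : nat) (M : 'M[R]_(\sum_i n_ i, k)) :
  \sum_i frobenius_sq (submxcol M i) = frobenius_sq M.
Proof.
rewrite /frobenius_sq sig_big_dep/= (reindex _ tagnat.sig_bij_on)/=.
apply: eq_bigr => s _; apply: eq_bigr => j _; rewrite mxE.
by rewrite -[in RHS](tagnat.sig2K s).
Qed.

(* This is 1, but only its finiteness is needed: both costs scale with it. *)
Definition gauss_sq (R : realType) : R :=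
  fine (\int[normal_prob (0 : R) 1]_x (x ^+ 2)%R%:E)%E.

Lemma expectation_filtered_noise d (T : measurableType d) (R : realType)
    (P : probability T R) (k p : nat) (w : int -> T -> 'cV[R]_k)
    (M : nat -> 'M[R]_(p, k)) (t : nat) : white_noise P w ->
  ('E_P[fun om => sqnorm (\sum_(s < t) M s *m w (t - 1 - s)%N om)%R] =
   (gauss_sq R * \sum_(s < t) frobenius_sq (M s))%R%:E)%E.
Proof.
move=> wP.
(* Delay and coordinate together index an orthogonal family; [K] is the Gram matrix of the
   corresponding columns, so its trace is the sum of the squared Frobenius norms. *)
pose f (a : 'I_t * 'I_k) om : R := w (t - 1 - a.1)%N om a.2 0.
pose K (a b : 'I_t * 'I_k) := \sum_i M a.1 i a.2 * M b.1 i b.2.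
transitivity ('E_P[fun om => (\sum_a \sum_b K a b * (f a om * f b om))%R])%E.
  congr expectation; apply/funext => om.
  rewrite /sqnorm.
  transitivity (\sum_(i < p) (\sum_(a : 'I_t * 'I_k) M a.1 i a.2 * f a om) ^+ 2).
    apply: eq_bigr => i _; congr (_ ^+ 2); rewrite summxE.
    by under eq_bigr do rewrite mxE; rewrite pair_bigA.
  under eq_bigr do rewrite expr2 big_distrlr/=.
  rewrite exchange_big/=; apply: eq_bigr => a _; rewrite exchange_big/=.
  apply: eq_bigr => b _; rewrite mulr_suml; apply: eq_bigr => i _.
  by rewrite mulrACA.
rewrite (@integral_quadratic_form _ _ _ _ _ _ _ (gauss_sq R)).
- congr (_ * _)%:E; rewrite -(pair_bigA _ (fun s j => K (s, j) (s, j)))/=.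
  apply: eq_bigr => s _.
  by rewrite /K exchange_big/=; apply: eq_bigr => i _; apply: eq_bigr => j _; rewrite expr2.
- by move=> a b; exact: white_noise_integrable.
- move=> [r i] [s j]; rewrite white_noise_cross//=.
  (* Truncated subtraction is injective here because both delays are below [t]. *)
  have -> : (t - 1 - r == t - 1 - s)%N = (r == s).
    by have := ltn_ord r; have := ltn_ord s; rewrite -val_eqE /=; lia.
  rewrite -xpair_eqE; case: ifP => // _; rewrite fineK//.
  exact: integrable_fin_num (normal_prob_integrable_sqr R).
Qed.

(** * Causal filters and closed-loop impulse responses *)

Lemma filter_out_causal (R : realType) (a b : nat) (g : nat -> 'M[R]_(a, b))
    (w : int -> 'cV[R]_b) (t : nat) : (forall s : int, s < 0 -> w s = 0) ->
  filter_out g w t = \sum_(s < t) g s *m w (t - 1 - s)%N.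
Proof.
move=> w0; rewrite /filter_out; apply: norm_lim_near_cst.
(* For [s >= t] the time [t - 1 - s] is negative, where [w] vanishes, so the partial sums are
   constant from [k = t] on. *)
exists t => // k /= tk.
rewrite (big_cat_nat (n := t))//= [X in _ + X]big_nat_cond [X in _ + X]big1 ?addr0.
  rewrite big_mkord; apply: eq_bigr => s _; congr (_ *m w _).
  by have := ltn_ord s; lia.
move=> s; rewrite andbT => /andP[ts _]; rewrite w0 ?mulmx0//.
by lia.
Qed.

(** For [F = 1%:M] this is the impulse response [X] from the noise to the feedforward state. *)
Fixpoint closed_loop (R : pzRingType) (n m p : nat) (A : 'M[R]_n)
    (B : 'M[R]_(n, m)) (F : 'M[R]_(n, p)) (g : nat -> 'M[R]_(m, p)) (s : nat)
    : 'M[R]_(n, p) :=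
  if s is s'.+1 then A *m closed_loop A B F g s' - B *m g s' else F.

(** Unrolls the recursion at its first step, as the induction on time for the estimation error
    requires. *)
Lemma closed_loop_shift (R : pzRingType) (n m p : nat) (A : 'M[R]_n)
    (B : 'M[R]_(n, m)) (F : 'M[R]_(n, p)) (g : nat -> 'M[R]_(m, p)) (s : nat) :
  closed_loop A B F g s.+1 =
  closed_loop A B (A *m F - B *m g 0) (fun i => g i.+1) s.
Proof. by elim: s => //= s <-. Qed.

(** The newest noise enters with coefficient [1%:M], and one time step turns each older coefficient
    [X s] into [A X s - B g s]. *)
Lemma state_closed_loop (R : realType) (n m : nat) (A : 'M[R]_n)
    (B : 'M[R]_(n, m)) (g : nat -> 'M[R]_(m, n)) (w : int -> 'cV[R]_n)
    (t : nat) : (forall s : int, s < 0 -> w s = 0) ->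
  state A (fun s => B *m - filter_out g w s + w s) t =
  \sum_(s < t) closed_loop A B 1%:M g s *m w (t - 1 - s)%N.
Proof.
move=> w0; rewrite /state; elim: t => [|t IHt]; first by rewrite big_ord0.
rewrite big_ord_recl/= mul1mx subn1 subn0/= [RHS]addrC addrA; congr (_ + _).
rewrite IHt filter_out_causal// mulmxN !mulmx_sumr -sumrB.
apply: eq_bigr => s _; rewrite !mulmxA -mulmxBl/= /bump/=.
by congr (_ *m w _); lia.
Qed.

(* Stated for an arbitrary [F], so that peeling off the latest output in the
   induction on [t] turns [F] into [A *m F - B *m g 0] and shifts [g]. *)
Lemma state_estimation_error (R : realType) (n m q p : nat) (A : 'M[R]_n)
    (B : 'M[R]_(n, m)) (C : 'M[R]_(q, n)) (D : 'M[R]_(q, m))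
    (F : 'M[R]_(n, p)) (g : nat -> 'M[R]_(m, p)) (v : int -> 'cV[R]_q)
    (t : nat) :
  let x := state A^T (fun s => C^T *m v s) in
  let y s := B^T *m x s + D^T *m v s in
  F^T *m x t - \sum_(s < t) (g s)^T *m y (t - 1 - s)%N =
  \sum_(s < t) (C *m closed_loop A B F g s - D *m g s)^T *m v (t - 1 - s)%N.
Proof.
move=> x y; elim: t F g => [|t IHt] F g.
  by rewrite !big_ord0 /x/= mulmx0 subr0.
rewrite !big_ord_recl/= subn1 subn0/=.
have shift (s : 'I_t) : (t - bump 0 s = t - 1 - s)%N by rewrite /bump/=; lia.
under eq_bigr do rewrite shift.
under [in RHS]eq_bigr do
  rewrite shift -[_ - _]/(C *m closed_loop A B F g _.+1 - _) closed_loop_shift.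
(* With [F] replaced by [A *m F - B *m g 0], what remains is the one-step identity [F^T x(t+1) - (g
   0)^T y(t) = (A F - B g 0)^T x(t) + (C F - D g 0)^T v(t)]. *)
rewrite -IHt.
rewrite /y !linearB /= -[state_nat _ _ t]/(x t).
rewrite !trmx_mul !mulmxBl !mulmxDr !mulmxA.
rewrite !opprD !addrA; congr (_ - _).
by rewrite [LHS]addrAC; congr (_ - _); rewrite [RHS]addrC addrA.
Qed.

(** * Transposed sparsity and time averages *)

Lemma trmx_expr (R : comPzSemiRingType) (k : nat) (E : 'M[R]_k) (t : nat) :
  (E^T) ^+ t = (E ^+ t)^T.
Proof.
elim: t => [|t IHt]; first by rewrite !expr0 trmx1.
by rewrite exprS IHt exprSr; exact/esym/trmx_mul.
Qed.

Lemma sparse_tr (R : realType) (N : nat) (E : 'M[nat]_N) (a b : 'I_N -> nat)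
    (g : nat -> 'M[R]_(\sum_i a i, \sum_i b i)) :
  sparse R E a b g -> sparse R E^T b a (fun s => (g s)^T).
Proof.
move=> gE t i j; rewrite trmx_expr mxE => /gE g0.
by rewrite -[RHS]trmx0 -g0; apply/matrixP => k l; rewrite !mxE.
Qed.

Lemma eq_average (R : realType) (e e' : int -> \bar R) :
  (forall t : nat, e t = e' t) -> average e = average e'.
Proof.
move=> ee'; rewrite /average; congr (limn _); apply/funext => M.
by under eq_bigr do rewrite ee'.
Qed.

(** * Equality of the two costs *)

Section duality.
Context (R : realType) (N : nat) (n_ m_ : 'I_N -> nat) (q : nat).
Local Notation n := (\sum_i n_ i)%N.
Local Notation m := (\sum_i m_ i)%N.
Context (A : 'M[R]_n) (B : 'M[R]_(n, m)) (C : 'M[R]_(q, n)) (D : 'M[R]_(q, m)).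
Context (g : nat -> 'M[R]_(m, n)).

(** Impulse response from [w] to [z]; its transpose is the one from the measurement noise to the
    estimation error. *)
Let H s := C *m closed_loop A B 1%:M g s - D *m g s.

Lemma ff_stage_cost d (T : measurableType d) (P : probability T R)
    (w : int -> T -> 'cV[R]_n) (t : nat) : white_noise P w ->
  ('E_P[fun om => sqnorm (ff_z A B C D w g t om)] =
   (gauss_sq R * \sum_(s < t) frobenius_sq (H s))%R%:E)%E.
Proof.
move=> wP; rewrite -(expectation_filtered_noise H t wP).
congr expectation; apply/funext => om; congr sqnorm.
have w0 (s : int) : s < 0 -> w s om = 0 by case: wP => w0 _ _ /w0.
rewrite /ff_z /ff_x /ff_u state_closed_loop// filter_out_causal// mulmxN.
rewrite !mulmx_sumr -sumrB; apply: eq_bigr => s _.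
by rewrite !mulmxA -mulmxBl.
Qed.

Lemma est_stage_cost d (T : measurableType d) (P : probability T R)
    (v : int -> T -> 'cV[R]_q) (t : nat) : white_noise P v ->
  (\sum_(i < N) 'E_P[fun om => sqnorm (submxcol (est_x A C v t om) i
     - submxcol (est_xhat A B C D v (fun s => (g s)^T) t om) i)] =
   (gauss_sq R * \sum_(s < t) frobenius_sq (H s))%R%:E)%E.
Proof.
move=> vP.
transitivity (\sum_(i < N) (gauss_sq R *
  \sum_(s < t) frobenius_sq (submxcol (H s)^T i))%R%:E)%E.
  apply: eq_bigr => i _.
  rewrite -(expectation_filtered_noise (fun s => submxcol (H s)^T i) t vP).
  congr expectation; apply/funext => om; congr sqnorm.
  have v0 (s : int) : s < 0 -> v s om = 0 by case: vP => v0 _ _ /v0.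
  rewrite /est_xhat filter_out_causal => [|s s0]; last first.
    (* The filter input is now [y], which vanishes before time 0 because both the state and the
       noise do. *)
    by rewrite /est_y /est_x state_le0 ?ltW// v0// !mulmx0 addr0.
  (* Taking [F = 1%:M] turns the general identity into one for the estimation error itself. *)
  have := state_estimation_error A B C D 1%:M g (v ^~ om) t.
  rewrite /= trmx1 mul1mx -submxcolB => ->.
  rewrite submxcol_sum.
  by apply: eq_bigr => s _; rewrite submxcol_mul.
rewrite sumEFin -mulr_sumr exchange_big/=; congr (_ * _)%:E.
by apply: eq_bigr => s _; rewrite sum_frobenius_sq_submxcol frobenius_sq_tr.
Qed.

Lemma ff_cost_est_cost d (T : measurableType d) (P : probability T R)
    (w : int -> T -> 'cV[R]_n) d' (T' : measurableType d')
    (P' : probability T' R) (v : int -> T' -> 'cV[R]_q) :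
  white_noise P w -> white_noise P' v ->
  ff_cost A B C D P w g = est_cost A B C D P' v (fun s => (g s)^T).
Proof.
move=> wP vP; apply: eq_average => t.
by rewrite ff_stage_cost// est_stage_cost.
Qed.

End duality.

Theorem theorem4 (R : realType) (N : nat) (n_ m_ : 'I_N -> nat) (q : nat)
  (n_gt0 : forall i, (0 < n_ i)%N) (m_gt0 : forall i, (0 < m_ i)%N)
  (A : 'M[R]_(\sum_i n_ i)) (B : 'M[R]_(\sum_i n_ i, \sum_i m_ i))
  (C : 'M[R]_(q, \sum_i n_ i)) (D : 'M[R]_(q, \sum_i m_ i))
  (B_diag : forall i j, i != j -> submxblock B i j = 0)
  (B_rank : forall i, \rank (submxblock B i i) = m_ i)
  (d : measure_display) (T : measurableType d) (P : probability T R)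
  (w : int -> T -> 'cV[R]_(\sum_i n_ i)) (w_noise : white_noise P w)
  (d' : measure_display) (T' : measurableType d') (P' : probability T' R)
  (wbar : int -> T' -> 'cV[R]_q) (wbar_noise : white_noise P' wbar)
  (g : nat -> 'M[R]_(\sum_i m_ i, \sum_i n_ i)) :
  is_solution (sparse R (adjacency A) m_ n_) (ff_cost A B C D P w) g <->
  is_solution (sparse R (adjacency A)^T n_ m_) (est_cost A B C D P' wbar)
    (fun s => (g s)^T).
Proof.
have costE h := ff_cost_est_cost A B C D h w_noise wbar_noise.
have trK a b (h : nat -> 'M[R]_(a, b)) : (fun s => (h s)^T^T) = h.
  by apply/funext => s; rewrite trmxK.
have sparseE h : sparse R (adjacency A) m_ n_ h <->
    sparse R (adjacency A)^T n_ m_ (fun s => (h s)^T).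
  split=> [|hS]; first exact: sparse_tr.
  by have := sparse_tr hS; rewrite trmxK trK.
(* Transposition is a cost-preserving bijection between the feasible sets, so both infima range over
   the same set of values. *)
rewrite /is_solution -costE sparseE; suff -> : [set ff_cost A B C D P w h
    | h in sparse R (adjacency A) m_ n_] = [set est_cost A B C D P' wbar l
    | l in sparse R (adjacency A)^T n_ m_] by [].
apply/seteqP; split=> _ [h hS <-].
  by exists (fun s => (h s)^T); [exact/sparseE|rewrite costE].
by exists (fun s => (h s)^T); [apply/sparseE; rewrite trK|rewrite costE trK].
Qed.
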